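(* Let $G$ be a finite, simple, connected $3$-$\gamma_{c}$-critical graph with $\delta(G) \geq 2$. If $\kappa(G) \leq \delta(G) - 1$, then $\alpha(G) \leq \kappa(G)$ or $G \in \mathcal{G}_{2}(3,3)$.
   Context: All graphs are finite, simple and connected. A set $D \subseteq V(G)$ is a connected dominating set of $G$ if every vertex of $G$ is in $D$ or adjacent to a vertex of $D$, and $G[D]$ is connected; $\gamma_{c}(G)$ is the minimum size of such a set. For non-adjacent $u,v$, $G+uv$ is $G$ with edge $uv$ added. $G$ is $3$-$\gamma_{c}$-critical if $\gamma_{c}(G)=3$ and $\gamma_{c}(G+uv)<3$ for every pair of non-adjacent vertices $u,v$. $\alpha(G)$ is the independence number, $\delta(G)$ the minimum degree, $\kappa(G)$ the connectivity (minimum size of a vertex set whose removal disconnects $G$). The class $\mathcal{G}_{2}(3,3)$: take integers $j_1, j_2 \geq 3$, pairwise disjoint vertex sets $J_1, J_2$ with $|J_1| = j_1$, $|J_2| = j_2$, two distinct vertices $u_1, u_2 \in J_2$, and three further vertices $w, w_1, v_1$. Form the graph on $J_1 \cup J_2 \cup \{w, w_1, v_1\}$ whose edges are exactly: all edges inside $J_1$, all edges inside $J_2$, $v_1$ joined to every vertex of $J_1$, $w_1$ joined to every vertex of $J_1 \cup (J_2 \setminus \{u_1\}) \cup \{w\}$, and $w$ joined to every vertex of $J_1 \cup (J_2 \setminus \{u_2\}) \cup \{w_1\}$. $\mathcal{G}_{2}(3,3)$ is the class of all graphs (up to isomorphism) obtained this way. *)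

(* Defs.v *)
From mathcomp Require Import all_boot.

Set Implicit Arguments.
Unset Strict Implicit.
Unset Printing Implicit Defensive.

(* A finite simple graph is a symmetric irreflexive relation e on a finType. *)

Section GraphNotions.

Variables (T : finType) (e : rel T).
Implicit Types (D S : {set T}) (x y u v : T).

Definition induced D : rel T := [rel x y | [&& x \in D, y \in D & e x y]].

(* The empty set counts as connected: deleting all vertices is not a cut, and
   the empty set is not dominating unless T is empty. *)
Definition connected_on D : bool :=
  [forall x in D, forall y in D, connect (induced D) x y].

Definition connected_graph : bool := connected_on [set: T].

Definition dominating D : bool :=
  [forall x, (x \in D) || [exists y in D, e x y]].

Definition connected_dominating D : bool := dominating D && connected_on D.

(* In a connected graph the full vertex set is connected dominating, so the
   default value #|T| is harmless. *)
Definition gamma_c : nat :=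
  \big[minn/#|T|]_(D : {set T} | connected_dominating D) #|D|.

Definition add_edge u v : rel T :=
  [rel x y | [|| e x y, (x == u) && (y == v) | (x == v) && (y == u)]].

Definition independent S : bool :=
  [forall x in S, forall y in S, ~~ e x y].

Definition alpha : nat := \max_(S : {set T} | independent S) #|S|.

Definition degree x : nat := #|[set y | e x y]|.

(* Degrees are smaller than #|T|, so the default only matters if T is empty. *)
Definition min_degree : nat := \big[minn/#|T|]_(x : T) degree x.

Definition vertex_cut S : bool := ~~ connected_on (~: S).

(* A vertex cut leaves at least two vertices, so the default is attained only
   by graphs without vertex cuts, i.e. complete graphs. *)
Definition kappa : nat :=
  \big[minn/#|T|.-1]_(S : {set T} | vertex_cut S) #|S|.

End GraphNotions.

Definition gamma_c_critical3 (T : finType) (e : rel T) : Prop :=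
  gamma_c e = 3 /\
  forall u v : T, u != v -> ~~ e u v -> gamma_c (add_edge e u v) < 3.

Section ClassG2.

Variable T : finType.

Definition G2_33_arc (J1 J2 : {set T}) (u1 u2 w w1 v1 : T) : rel T :=
  [rel x y |
    [|| [&& x \in J1, y \in J1 & x != y],
        [&& x \in J2, y \in J2 & x != y],
        (x == v1) && (y \in J1),
        (x == w1) && (y \in J1 :|: (J2 :\ u1) :|: [set w])
      | (x == w) && (y \in J1 :|: (J2 :\ u2) :|: [set w1])]].

Definition G2_33_edge (J1 J2 : {set T}) (u1 u2 w w1 v1 : T) : rel T :=
  [rel x y | G2_33_arc J1 J2 u1 u2 w w1 v1 x y
          || G2_33_arc J1 J2 u1 u2 w w1 v1 y x].

(* Membership up to isomorphism: the vertices of (T, e) themselves can be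
   labelled so that the edges are exactly those of the construction. *)
Definition in_G2_33 (e : rel T) : Prop :=
  exists (J1 J2 : {set T}) (u1 u2 w w1 v1 : T),
    [/\ [/\ 3 <= #|J1|, 3 <= #|J2| & [disjoint J1 & J2]],
        [/\ u1 \in J2, u2 \in J2 & u1 != u2],
        uniq [:: w; w1; v1] /\ [disjoint J1 :|: J2 & [set w; w1; v1]],
        J1 :|: J2 :|: [set w; w1; v1] = [set: T]
      & e =2 G2_33_edge J1 J2 u1 u2 w w1 v1].

End ClassG2.

(* Main.v *)
Require Import Defs.
From mathcomp Require Import all_boot all_order zify.

(** In a 3-gamma_c-critical graph no edge dominates, and nonadjacent vertices
    [u], [v] either dominate together or one of them, say [u], has a neighbour
    [z] such that [u] and [z] dominate everything except [v].

    Let [S] be a minimum cut.  As [#|S|] is less than the minimum degree, every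
    vertex outside [S] has a neighbour on its own side, so the [z] attached to a
    [u] outside [S] lies in [S].  Let [I] be independent with [#|S| + 1 >= 3]
    elements.  No two elements of [I] dominate, so among any two elements of
    [I :\: S] one is the only element of [I] missed by some vertex of [S :\: I].
    Counting shows that exactly one [a0] in [I :\: S] is not missed in this way
    and that [S :\: I] is matched with the other elements of [I :\: S].  If [A]
    is the side of [a0] and [B] the other one, criticality applied to [a0] and
    [B] puts the matched elements of [I] inside [B] and joins [B :\: I]
    completely to [S].  Pairs between [A] and [B] then leave a single matched
    vertex, hence a cut of size two, and force all remaining adjacencies. *)

Set Implicit Arguments.
Unset Strict Implicit.
Unset Printing Implicit Defensive.

Lemma bigminn_lt_exists (I : finType) n (P : pred I) (F : I -> nat) k :
  \big[minn/n]_(i | P i) F i < k -> k <= n -> exists2 i, P i & F i < k.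
Proof.
move=> lt_k le_kn; apply/exists_inP; apply: contraTT lt_k.
rewrite negb_exists_in -leqNgt => /forall_inP leF.
apply/(@Order.TotalTheory.bigmin_geP _ nat); split=> // i Pi.
by have := leF i Pi; rewrite -leqNgt.
Qed.

Lemma subset_of_card (T : finType) (A : {set T}) k :
  k <= #|A| -> exists2 B : {set T}, B \subset A & #|B| = k.
Proof.
rewrite -bin_gt0 -cards_draws => /card_gt0P[B].
by rewrite inE => /andP[BA /eqP]; exists B.
Qed.

Lemma card_lt3_set2 (T : finType) (A : {set T}) :
  A != set0 -> #|A| < 3 -> exists x y, A = [set x; y].
Proof.
rewrite -card_gt0 => A_gt0 A_lt3.
have [/cards1P[x ->]|A_neq1] := boolP (#|A| == 1).
  by exists x, x; rewrite setUid.
have /cards2P[x [y [_ ->]]] : #|A| == 2 by lia.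
by exists x, y.
Qed.

Lemma card_gt2_other (T : finType) (A : {set T}) a b :
  2 < #|A| -> exists2 c, c \in A & (c != a) && (c != b).
Proof.
move=> A_gt2; have /subsetPn[c cA] : ~~ (A \subset [set a; b]).
  apply: contraL A_gt2 => /subset_leq_card; rewrite -leqNgt.
  by move/leq_trans; apply; rewrite cards2; case: (a != b).
by rewrite !inE negb_or; exists c.
Qed.

Section Invariants.

Variables (T : finType) (e : rel T).

Lemma min_degree_le x : min_degree e <= degree e x.
Proof. exact: (@Order.TotalTheory.bigmin_le _ nat). Qed.

Lemma kappa_attained :
  kappa e < #|T|.-1 -> exists2 S, vertex_cut e S & #|S| <= kappa e.
Proof. by move=> lt_kappa; apply: bigminn_lt_exists lt_kappa. Qed.

Lemma independent_of_card k :
  k <= alpha e -> exists2 I, independent e I & #|I| = k.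
Proof.
have ind0 : independent e set0 by apply/forall_inP => x; rewrite inE.
have [J indJ ->] : exists2 J, independent e J & alpha e = #|J|.
  have [|J indJ maxJ] := @eq_bigmax_cond _ (independent e) (fun J => #|J|).
    by apply/card_gt0P; exists set0.
  by exists J.
case/subset_of_card=> I /subsetP sIJ <-; exists I => //.
apply/forall_inP => x /sIJ xJ; apply/forall_inP => y /sIJ yJ.
exact: forall_inP (forall_inP indJ x xJ) y yJ.
Qed.

End Invariants.

Section ClosedNeighborhood.

Variables (T : finType) (e : rel T).
Hypothesis e_sym : symmetric e.

Definition closed_nbhd x := [set y | (y == x) || e x y].

Local Notation "'N[' x ]" := (closed_nbhd x).

Lemma in_closed_nbhd x y : (y \in N[x]) = (y == x) || e x y.
Proof. by rewrite inE. Qed.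

Lemma closed_nbhd_refl x : x \in N[x].
Proof. by rewrite inE eqxx. Qed.

Lemma closed_nbhdC x y : (y \in N[x]) = (x \in N[y]).
Proof. by rewrite !in_closed_nbhd eq_sym e_sym. Qed.

Lemma card_closed_nbhd x : irreflexive e -> #|N[x]| = (degree e x).+1.
Proof.
move=> e_irr; have -> : N[x] = x |: [set y | e x y].
  by apply/setP => y; rewrite !inE.
by rewrite cardsU1 inE e_irr.
Qed.

Lemma independent_closed_nbhd I a c :
  independent e I -> a \in I -> c \in I -> (c \in N[a]) = (c == a).
Proof.
move=> /forall_inP/(_ a)/[apply]/forall_inP/(_ c)/[apply]/negbTE.
by rewrite in_closed_nbhd => ->; rewrite orbF.
Qed.

Definition dominating_pair x y := N[x] :|: N[y] == setT.

Lemma dominating_pairC x y : dominating_pair x y = dominating_pair y x.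
Proof. by rewrite /dominating_pair setUC. Qed.

Lemma dominating_pairP x y v :
  dominating_pair x y -> v \notin N[x] -> v \in N[y].
Proof.
move=> /eqP/setP/(_ v); rewrite in_setT in_setU => dom /negbTE vNx.
by rewrite vNx in dom.
Qed.

Lemma dominatingE D : dominating e D = (\bigcup_(x in D) N[x] == setT).
Proof.
rewrite -subTset; apply/forallP/subsetP => dom x.
  move=> _; apply/bigcupP; have /orP[xD|/exists_inP[y yD exy]] := dom x.
    by exists x; rewrite // closed_nbhd_refl.
  by exists y; rewrite // closed_nbhdC in_closed_nbhd exy orbT.
have /bigcupP[y yD] := dom x (in_setT x).
rewrite in_closed_nbhd => /predU1P[->|eyx]; first by rewrite yD.
by apply/orP; right; apply/exists_inP; exists y; rewrite // e_sym.
Qed.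

Lemma connect_induced_sym D : connect_sym (induced e D).
Proof.
by apply: sym_connect_sym => x y; rewrite /induced /= andbCA e_sym.
Qed.

Lemma connected_on_set2 x y : connected_on e [set x; y] = (y \in N[x]).
Proof.
have xD := set21 x y; have yD := set22 x y.
apply/forall_inP/idP => [con|yNx].
  have xy := forall_inP (con x xD) y yD; apply: contraT.
  rewrite in_closed_nbhd negb_or => /andP[yx exy].
  have closed_x : closed (induced e [set x; y]) (mem [set x]).
    apply: (intro_closed (connect_induced_sym _)) => a b.
    case/and3P=> _ bD eab /set1P ax; move: bD eab; rewrite ax !inE.
    by case/orP=> // /eqP->; rewrite (negbTE exy).
  by have := closed_connect closed_x xy; rewrite !inE eqxx (negbTE yx).
have cxy : connect (induced e [set x; y]) x y.
  move: yNx; rewrite in_closed_nbhd => /predU1P[->|exy]; first exact: connect0.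
  by apply: connect1; rewrite /induced /= xD yD.
have cyx : connect (induced e [set x; y]) y x by rewrite connect_induced_sym.
by move=> a /set2P[]->; apply/forall_inP => b /set2P[]->.
Qed.

Lemma dominating_set2 x y : dominating e [set x; y] = dominating_pair x y.
Proof. by rewrite dominatingE bigcup_setU !big_set1. Qed.

Lemma gamma_c_lt3P : 2 < #|T| ->
  reflect (exists x y, y \in N[x] /\ dominating_pair x y) (gamma_c e < 3).
Proof.
move=> T_gt2; apply: (iffP idP) => [lt3|[x [y [yNx dom]]]].
  have [D /andP[domD conD] D_lt3] := bigminn_lt_exists lt3 T_gt2.
  have D_neq0 : D != set0.
    apply: contraTneq domD => ->; rewrite dominatingE big_set0 eq_sym.
    by rewrite -card_gt0 cardsT; lia.
  have [x [y Dxy]] := card_lt3_set2 D_neq0 D_lt3; exists x, y.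
  by rewrite -dominating_set2 -connected_on_set2 -Dxy.
have conn_dom : connected_dominating e [set x; y].
  by rewrite /connected_dominating dominating_set2 connected_on_set2 dom.
apply: (@leq_ltn_trans #|[set x; y]|); last by rewrite cards2; case: (x != y).
exact: (@Order.TotalTheory.bigmin_le_cond _ nat).
Qed.

End ClosedNeighborhood.

Section AddEdge.

Variables (T : finType) (e : rel T).
Implicit Types u v p : T.

Lemma add_edgeC u v : add_edge e u v =2 add_edge e v u.
Proof. by move=> x y; congr orb; exact: orbC. Qed.

Lemma add_edge_sym u v : symmetric e -> symmetric (add_edge e u v).
Proof.
move=> e_sym x y; rewrite /add_edge /= e_sym; congr orb.
by rewrite orbC; congr orb; exact: andbC.
Qed.

Lemma closed_nbhd_add_edgeC u v p :
  closed_nbhd (add_edge e u v) p = closed_nbhd (add_edge e v u) p.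
Proof. by apply/setP => y; rewrite !in_closed_nbhd add_edgeC. Qed.

Lemma closed_nbhd_add_edge_end u v :
  closed_nbhd (add_edge e u v) u = v |: closed_nbhd e u.
Proof.
apply/setP => y; rewrite !inE /add_edge /= eqxx /=.
by case: (y == u); case: (y == v); rewrite ?andbF ?orbF ?orbT.
Qed.

Lemma closed_nbhd_add_edge_off u v p :
  p != u -> p != v -> closed_nbhd (add_edge e u v) p = closed_nbhd e p.
Proof.
move=> /negbTE pu /negbTE pv; apply/setP => y.
by rewrite !inE /add_edge /= pu pv !orbF.
Qed.

End AddEdge.

Section Critical.

Variables (T : finType) (e : rel T).
Hypotheses (e_sym : symmetric e) (e_crit : gamma_c_critical3 e).
Implicit Types (A B I J S : {set T}) (a b c u v x y z : T).

Local Notation "'N[' x ]" := (closed_nbhd e x).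

Let nbhdC x y : (y \in N[x]) = (x \in N[y]) := closed_nbhdC e_sym x y.

(* Written [{x, z} ->_c y] in the literature; here [z = x] is allowed. *)
Definition dominates_but x z y := (z \in N[x]) && (N[x] :|: N[z] == [set~ y]).

Lemma dominates_butP x z y :
  reflect [/\ z \in N[x], y \notin N[x], y \notin N[z]
            & forall v, v != y -> v \notin N[x] -> v \in N[z]]
          (dominates_but x z y).
Proof.
apply: (iffP andP) => [[zNx /eqP/setP dom]|[zNx yNx yNz dom]].
  have := dom y; rewrite in_setU in_setC1 eqxx => /norP[yNx yNz].
  split=> // v vy /negbTE vNx.
  by have := dom v; rewrite in_setU in_setC1 vNx vy.
split=> //; apply/eqP/setP => v; rewrite in_setU in_setC1.
have [->|vy] := eqVneq v y; first by rewrite (negbTE yNx) (negbTE yNz).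
by have [//|/(dom v vy) ->] := boolP (v \in N[x]).
Qed.

Lemma critical_card_gt2 : 2 < #|T|.
Proof.
by have [<- _] := e_crit; apply: (@Order.TotalTheory.bigmin_le_id _ nat).
Qed.

Lemma edge_not_dominating x y : y \in N[x] -> ~~ dominating_pair e x y.
Proof.
move=> yNx; apply/negP => dom; have [g3 _] := e_crit.
suff: gamma_c e < 3 by rewrite g3.
by apply/(gamma_c_lt3P e_sym critical_card_gt2); exists x, y.
Qed.

Lemma edge_undominated x y :
  y \in N[x] -> exists2 v, v \notin N[x] & v \notin N[y].
Proof.
move=> /edge_not_dominating; rewrite /dominating_pair -subTset.
by case/subsetPn=> v _; rewrite in_setU => /norP[]; exists v.
Qed.

Lemma add_edge_dominates_but u v z (e' := add_edge e u v) :
  v \notin N[u] -> z != v -> z \in closed_nbhd e' u -> dominating_pair e' u z ->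
  dominates_but u z v.
Proof.
move=> vNu zv; rewrite closed_nbhd_add_edge_end in_setU1 (negbTE zv) /=.
move=> zNu dom; have cover w : w != v -> w \notin N[u] -> w \in N[z].
  move=> wv wNu; have := dominating_pairP (v := w) dom.
  rewrite closed_nbhd_add_edge_end in_setU1 (negbTE wv) => /(_ wNu).
  have [->|zu] := eqVneq z u; last by rewrite closed_nbhd_add_edge_off.
  by rewrite closed_nbhd_add_edge_end in_setU1 (negbTE wv).
apply/dominates_butP; split=> //.
have [w wNu wNz] := edge_undominated zNu; have [<-//|wv] := eqVneq w v.
by rewrite cover in wNz.
Qed.

Lemma critical_nonadjacent u v : v \notin N[u] ->
  [\/ dominating_pair e u v, exists z, dominates_but u z v
    | exists z, dominates_but v z u].
Proof.
move=> vNu; have [_ /(_ u v)] := e_crit.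
have [vu euv] : v != u /\ ~~ e u v by apply/norP; rewrite -in_closed_nbhd.
rewrite eq_sym => /(_ vu euv); set e' := add_edge e u v.
have e'_sym : symmetric e' := add_edge_sym u v e_sym.
case/(gamma_c_lt3P e'_sym critical_card_gt2) => p [q [qN dom]].
have end_pq : (p \in [set u; v]) || (q \in [set u; v]).
  apply: contraT; rewrite !inE !negb_or => /andP[/andP[pu pv] /andP[qu qv]].
  rewrite /dominating_pair !closed_nbhd_add_edge_off // in qN dom.
  by case/negP: (edge_not_dominating qN).
wlog p_end : p q qN dom {end_pq} / p \in [set u; v].
  have /orP[p_end|q_end] := end_pq => [/(_ p q)|/(_ q p)]; first exact.
  by rewrite dominating_pairC closed_nbhdC //; apply.
have ends : dominating_pair e' u v -> dominating_pair e u v.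
  rewrite /dominating_pair closed_nbhd_add_edge_end closed_nbhd_add_edgeC.
  rewrite closed_nbhd_add_edge_end setUACA (setUidPr _) //.
  by rewrite subUset !sub1set !in_setU !closed_nbhd_refl orbT.
have /set2P[] := p_end => Ep; subst p.
- have [qv|qv] := eqVneq q v; first by constructor 1; apply: ends; rewrite -qv.
  by constructor 2; exists q; apply: add_edge_dominates_but.
- have [qu|qu] := eqVneq q u.
    by constructor 1; apply: ends; rewrite dominating_pairC -qu.
  constructor 3; exists q; apply: add_edge_dominates_but => //.
  + by rewrite nbhdC.
  + by rewrite closed_nbhd_add_edgeC.
  + by rewrite /dominating_pair !(closed_nbhd_add_edgeC _ v).
Qed.

(* The neighbour clauses hold when [S] is smaller than the minimum degree. *)
Record separation S A B : Prop := Separation {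
  sep_cut : S = ~: (A :|: B);
  sep_nonadjacent : {in A & B, forall a b, b \notin N[a]};
  sep_nbrl : {in A, forall a, exists2 x, x \in A :\ a & x \in N[a]};
  sep_nbrr : {in B, forall b, exists2 x, x \in B :\ b & x \in N[b]};
  sep_left_neq0 : A != set0;
  sep_right_neq0 : B != set0 }.

Lemma separationC S A B : separation S A B -> separation S B A.
Proof.
case=> cut nadj nbrA nbrB A0 B0; split=> //; first by rewrite setUC.
by move=> b a bB aA; rewrite nbhdC nadj.
Qed.

Lemma separation_cover S A B x :
  separation S A B -> [\/ x \in S, x \in A | x \in B].
Proof.
case=> -> _ _ _ _ _; rewrite inE in_setU.
have [xA|_] := boolP (x \in A); first by constructor 2.
by have [xB|_] := boolP (x \in B); [constructor 3 | constructor 1].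
Qed.

Lemma separation_cutF S A B x :
  separation S A B -> x \in S -> x \notin A /\ x \notin B.
Proof. by case=> -> _ _ _ _ _; rewrite inE in_setU => /norP. Qed.

Lemma separation_leftF S A B x :
  separation S A B -> x \in A -> x \notin S /\ x \notin B.
Proof.
move=> sp xA; split; first by apply: contraL xA => /(separation_cutF sp)[].
by apply/negP => /(sep_nonadjacent sp xA); rewrite closed_nbhd_refl.
Qed.

Lemma separation_adjF S A B a b : separation S A B -> a \in A -> b \in B ->
  ((b \in N[a]) = false) * ((a \in N[b]) = false).
Proof.
move=> sp aA bB; have /negbTE bNa := sep_nonadjacent sp aA bB.
by rewrite [a \in _]nbhdC bNa.
Qed.

Lemma separation_nbr_left S A B a x :
  separation S A B -> a \in A -> x \in N[a] -> x \notin S -> x \in A.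
Proof.
move=> sp aA xNa; case: (separation_cover x sp) => [->||xB] //.
by rewrite (separation_adjF sp aA xB) in xNa.
Qed.

Lemma connected_cut_nbr S A B :
  connected_graph e -> separation S A B ->
  exists b s, [/\ b \in B, s \in S & s \in N[b]].
Proof.
move=> con sp; have /set0Pn[a aA] := sep_left_neq0 sp.
have /set0Pn[b bB] := sep_right_neq0 sp.
have [/exists_inP[b' b'B /set0Pn[s /setIP[sS sNb]]]|noS] :=
  boolP [exists b in B, S :&: N[b] != set0]; first by exists b', s.
have closedB : closed (induced e setT) (mem B).
  apply: (intro_closed (connect_induced_sym e_sym _)) => x y /and3P[_ _ exy] xB.
  have yNx : y \in N[x] by rewrite in_closed_nbhd exy orbT.
  apply: (separation_nbr_left (separationC sp) xB yNx); apply: contra noS => yS.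
  by apply/exists_inP; exists x => //; apply/set0Pn; exists y; rewrite inE yS.
have ab := forall_inP (forall_inP con a (in_setT a)) b (in_setT b).
have [_] := separation_leftF sp aA.
by rewrite (closed_connect closedB ab) bB.
Qed.

Lemma vertex_cut_separation S :
  vertex_cut e S -> (forall x, #|S|.+1 < #|N[x]|) ->
  exists A B, separation S A B.
Proof.
case/forall_inPn=> a aS /forall_inPn[b bS ab] S_lt; move: aS bS; rewrite !inE.
set comp := connect (induced e (~: S)) a => aS bS.
have comp_step x y : x \notin S -> y \notin S -> y \in N[x] -> comp x = comp y.
  move=> xS yS; rewrite in_closed_nbhd => /predU1P[->//|exy].
  apply: (same_connect_r (connect_induced_sym e_sym _)); apply: connect1.
  by rewrite /induced /= !inE xS yS.
have nbr x : exists2 y, y \notin S & (y != x) && (y \in N[x]).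
  have /subsetPn[y] : ~~ (N[x] \subset x |: S).
    apply: contraL (S_lt x) => /subset_leq_card; rewrite -leqNgt => /leq_trans.
    by apply; rewrite cardsU1; case: (x \in S); lia.
  by move=> yNx; rewrite !inE => /norP[yx yS]; exists y; rewrite ?yx.
pose A := [set x in ~: S | comp x]; pose B := [set x in ~: S | ~~ comp x].
have inA x : (x \in A) = (x \notin S) && comp x by rewrite !inE.
have inB x : (x \in B) = (x \notin S) && ~~ comp x by rewrite !inE.
exists A, B; split.
- by apply/setP => x; rewrite inE in_setU inA inB -andb_orr orbN andbT negbK.
- move=> x y; rewrite inA inB => /andP[xS cx] /andP[yS]; apply: contra => xy.
  by rewrite -(comp_step x).
- move=> x; rewrite inA => /andP[xS cx]; have [y yS /andP[yx xy]] := nbr x.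
  by exists y; rewrite // in_setD1 yx inA yS -(comp_step x).
- move=> x; rewrite inB => /andP[xS cx]; have [y yS /andP[yx xy]] := nbr x.
  by exists y; rewrite // in_setD1 yx inB yS -(comp_step x).
- by apply/set0Pn; exists a; rewrite inA aS; apply: connect0.
- by apply/set0Pn; exists b; rewrite inB bS.
Qed.

Lemma dominates_but_across S A B u z v :
  separation S A B -> u \in A -> dominates_but u z v ->
  z \in S /\ {in B, forall b, b != v -> b \in N[z]}.
Proof.
move=> sp uA /dominates_butP[zNu vNu vNz dom].
have farB : {in B, forall b, b != v -> b \in N[z]}.
  by move=> b bB bv; apply: dom bv (sep_nonadjacent sp uA bB).
split=> //; have [b bB bv] : exists2 b, b \in B & b != v.
  have /set0Pn[b bB] := sep_right_neq0 sp.
  have [<-|bv] := eqVneq b v; last by exists b.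
  by have [b' /setD1P[b'b b'B] _] := sep_nbrr sp bB; exists b'.
apply: contraT => /(separation_nbr_left sp uA zNu) zA.
by have := sep_nonadjacent sp zA bB; rewrite farB.
Qed.

Lemma dominates_but_cut S A B u z v :
  separation S A B -> u \notin S -> dominates_but u z v -> z \in S.
Proof.
move=> sp /negbTE uS dom; case: (separation_cover u sp) => [|uA|uB].
- by rewrite uS.
- by have [] := dominates_but_across sp uA dom.
- by have [] := dominates_but_across (separationC sp) uB dom.
Qed.

Lemma cut_vertex_misses_side c A B b :
  separation [set c] A B -> b \in B -> b \in N[c] -> ~~ (A \subset N[c]).
Proof.
move=> sp bB bNc; apply/negP => /subsetP Nc_A.
have undominatedB b1 : b1 \in N[c] ->
    exists x, [/\ x \in B, x \notin N[c] & x \notin N[b1]].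
  case/edge_undominated=> x xNc xNb1; exists x; split=> //.
  case: (separation_cover x sp) => [/set1P xc|/Nc_A|//].
    by rewrite xc closed_nbhd_refl in xNc.
  by rewrite (negbTE xNc).
have [x [xB xNc xNb]] := undominatedB b bNc.
have /set0Pn[a aA] := sep_left_neq0 sp.
have [/dominating_pairP dom|[z dom]|[z dom]] :=
  critical_nonadjacent (sep_nonadjacent sp aA xB).
- by rewrite nbhdC dom ?(sep_nonadjacent sp) in xNb.
- have [/set1P zc Nz_B] := dominates_but_across sp aA dom; subst z.
  have [y /setD1P[yx yB] yNx] := sep_nbrr sp xB.
  have [v [vB vNc vNy]] := undominatedB y (Nz_B y yB yx).
  have [vx|vx] := eqVneq v x; last by rewrite Nz_B in vNc.
  by rewrite vx nbhdC yNx in vNy.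
- have [/set1P zc _] := dominates_but_across (separationC sp) xB dom.
  by case/dominates_butP: dom => zNx _ _ _; rewrite nbhdC -zc zNx in xNc.
Qed.

Lemma connected_cut_gt1 S A B :
  connected_graph e -> separation S A B -> 1 < #|S|.
Proof.
move=> con sp; rewrite ltnNge; apply/negP => S_le1.
have [b [c [bB cS cNb]]] := connected_cut_nbr con sp.
have [a [c' [aA c'S c'Na]]] := connected_cut_nbr con (separationC sp).
have ES : S = [set c].
  by apply/eqP; rewrite eq_sym eqEcard sub1set cS cards1.
move: c'S; rewrite ES => /set1P Ec'; subst S c'.
rewrite nbhdC in cNb; rewrite nbhdC in c'Na.
have /subsetPn[x xA xNc] := cut_vertex_misses_side sp bB cNb.
have /subsetPn[y yB yNc] := cut_vertex_misses_side (separationC sp) aA c'Na.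
have [dom|[z dom]|[z dom]] := critical_nonadjacent (sep_nonadjacent sp xA yB).
- case/negP: yNc; rewrite nbhdC; apply: (dominating_pairP dom).
  by rewrite nbhdC.
- have [/set1P zc _] := dominates_but_across sp xA dom.
  by case/dominates_butP: dom => zNx _ _ _; rewrite nbhdC -zc zNx in xNc.
- have [/set1P zc _] := dominates_but_across (separationC sp) yB dom.
  by case/dominates_butP: dom => zNy _ _ _; rewrite nbhdC -zc zNy in yNc.
Qed.

Section Extremal.

Variables (A B : {set T}) (w w1 u1 u2 v1 : T).
Hypotheses (e_irr : irreflexive e) (sp : separation [set w; w1] A B).
Hypotheses (u1A : u1 \in A) (u2A : u2 \in A) (v1B : v1 \in B) (u12 : u1 != u2).
Hypotheses (w1Nw : w1 \in N[w]).
Hypotheses (v1Nw : v1 \notin N[w]) (v1Nw1 : v1 \notin N[w1]).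
Hypotheses (u1Nw1 : u1 \notin N[w1]) (u2Nw : u2 \notin N[w]).
Hypothesis far_nbhd : {in B :\ v1, forall b, [set v1; w; w1] \subset N[b]}.
Hypothesis nbhd_gt3 : forall x, 3 < #|N[x]|.

Let J1 := B :\ v1.

Lemma end_nbhd_far : N[v1] \subset B.
Proof.
apply/subsetP => x xNv1; apply: (separation_nbr_left (separationC sp) v1B xNv1).
by apply: contraL xNv1 => /set2P[]->; rewrite nbhdC.
Qed.

Lemma end_far_nonadjacent u v :
  v1 \notin N[u] -> v1 \notin N[v] -> v \notin N[u] ->
  exists2 z, z \in B & dominates_but u z v \/ dominates_but v z u.
Proof.
move=> v1Nu v1Nv vNu; have v1F x : v1 \notin N[x] -> v1 != x.
  by apply: contraNneq => ->; rewrite closed_nbhd_refl.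
have zB z : v1 \in N[z] -> z \in B by rewrite nbhdC => /(subsetP end_nbhd_far).
have [dom|[z dom]|[z dom]] := critical_nonadjacent vNu.
- by rewrite (dominating_pairP dom v1Nu) in v1Nv.
- exists z; last by left.
  by have /dominates_butP[_ _ _ dom_z] := dom; apply/zB/dom_z => //; apply: v1F.
- exists z; last by right.
  by have /dominates_butP[_ _ _ dom_z] := dom; apply/zB/dom_z => //; apply: v1F.
Qed.

Lemma near_clique : {in A &, forall x y, y \in N[x]}.
Proof.
move=> x y xA yA; apply: contraT => yNx.
have v1F a (aA : a \in A) : v1 \notin N[a] := sep_nonadjacent sp aA v1B.
have [z zB dom] := end_far_nonadjacent (v1F x xA) (v1F y yA) yNx.
case: dom => /dominates_butP[+ _ _ _].
  by rewrite (separation_adjF sp xA zB).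
by rewrite (separation_adjF sp yA zB).
Qed.

Lemma near_adj_but s v y :
  v1 \notin N[s] -> v \in A -> v \notin N[s] -> y \in A -> y != v -> y \in N[s].
Proof.
move=> v1Ns vA vNs yA yv; have v1Nv := sep_nonadjacent sp vA v1B.
have [z zB [] /dominates_butP[zN _ _ dom]] := end_far_nonadjacent v1Ns v1Nv vNs.
  by apply: contraT => /(dom y yv); rewrite (separation_adjF sp yA zB).
by rewrite (separation_adjF sp vA zB) in zN.
Qed.

Lemma far_clique : {in B &, forall b c, c \in N[b]}.
Proof.
have adj_v1 b : b \in B -> v1 \in N[b].
  have [-> _|bv1 bB] := eqVneq b v1; first exact: closed_nbhd_refl.
  by apply: (subsetP (far_nbhd _)); rewrite ?in_setD1 ?bv1 // !inE eqxx.
have no_dominates_but b c z : b \in B -> c \in J1 -> ~ dominates_but b z c.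
  move=> bB cJ1 dom.
  have [zS _] := dominates_but_across (separationC sp) bB dom.
  case/dominates_butP: dom => _ _ + _; rewrite nbhdC => /negP; apply.
  by apply: (subsetP (far_nbhd cJ1)); rewrite -setUA in_setU zS orbT.
move=> b c bB cB; have [->|cv1] := eqVneq c v1; first exact: adj_v1.
have [->|bv1] := eqVneq b v1; first by rewrite nbhdC adj_v1.
apply: contraT => cNb; have [dom|[z]|[z]] := critical_nonadjacent cNb.
- have := dominating_pairP (v := u1) dom.
  rewrite (separation_adjF sp u1A bB) (separation_adjF sp u1A cB).
  by move/(_ isT).
- by move/no_dominates_but=> -[] //; rewrite in_setD1 cv1.
- by move/no_dominates_but=> -[] //; rewrite in_setD1 bv1.
Qed.

Let adjE x y : e x y = (y != x) && (y \in N[x]).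
Proof. by rewrite in_closed_nbhd; case: eqVneq => // ->; rewrite e_irr. Qed.

Let w_notin_sides : w \notin A /\ w \notin B.
Proof. by apply: separation_cutF sp _; rewrite set21. Qed.

Let w1_notin_sides : w1 \notin A /\ w1 \notin B.
Proof. by apply: separation_cutF sp _; rewrite set22. Qed.

Let w1_neq_w : w1 != w.
Proof.
by apply: contraNneq u1Nw1 => ->; apply: (near_adj_but v1Nw u2A).
Qed.

Lemma cut_adj_far s b : s \in [set w; w1] -> b \in J1 -> e s b.
Proof.
move=> sS bJ1; have /setD1P[_ bB] := bJ1; rewrite adjE; apply/andP; split.
  by apply: contraTneq bB => ->; have [] := separation_cutF sp sS.
rewrite nbhdC; apply: (subsetP (far_nbhd bJ1)).
by rewrite -setUA in_setU sS orbT.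
Qed.

Lemma cut_adj_near s v y : s \in [set w; w1] -> v1 \notin N[s] ->
  v \in A -> v \notin N[s] -> y \in A :\ v -> e s y.
Proof.
move=> sS v1Ns vA vNs /setD1P[yv yA].
rewrite adjE (near_adj_but v1Ns vA) // andbT.
by apply: contraTneq yA => ->; have [] := separation_cutF sp sS.
Qed.

Lemma extremal_arc_edge x y : G2_33_arc J1 A u1 u2 w w1 v1 x y -> e x y.
Proof.
case/or4P=> [/and3P[/setD1P[_ xB] /setD1P[_ yB] xy]|/and3P[xA yA xy]| |].
- by rewrite adjE eq_sym xy far_clique.
- by rewrite adjE eq_sym xy near_clique.
- by case/andP=> /eqP-> /setD1P[yv1 yB]; rewrite adjE yv1 far_clique.
case/orP=> /andP[/eqP->]; rewrite !in_setU -orbA => /or3P[yJ1|yA|/set1P->].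
- by rewrite cut_adj_far ?set22.
- by apply: cut_adj_near yA; rewrite ?set22.
- by rewrite e_sym adjE w1_neq_w.
- by rewrite cut_adj_far ?set21.
- by apply: cut_adj_near yA; rewrite ?set21.
- by rewrite adjE w1_neq_w.
Qed.

Lemma extremal_cut_arc s y :
  s \in [set w; w1] -> e s y -> G2_33_arc J1 A u1 u2 w w1 v1 s y.
Proof.
move=> sS; rewrite adjE => /andP[ys yNs]; rewrite /G2_33_arc /=.
have yv1 : y != v1.
  by apply: contraTneq yNs => ->; case/set2P: sS => ->.
case: (separation_cover y sp) => [yS|yA|yB]; last first.
- rewrite !in_setU [y \in J1]in_setD1 yv1 yB.
  by case/set2P: sS => ->; rewrite eqxx !orbT.
- case/set2P: sS ys yNs => -> ys yNs; rewrite eqxx !inE yA !andbT.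
  + suff -> : y != u2 by rewrite !orbT.
    by apply: contraTneq yNs => ->.
  + suff -> : y != u1 by rewrite !orbT.
    by apply: contraTneq yNs => ->.
- case/set2P: sS yS ys => -> /set2P[]->; rewrite ?eqxx // => _.
  + by rewrite !inE eqxx !orbT.
  + by rewrite !inE eqxx !orbT.
Qed.

Lemma extremal_edge : e =2 G2_33_edge J1 A u1 u2 w w1 v1.
Proof.
move=> x y; apply/idP/idP => [exy|/orP[]/extremal_arc_edge//]; last first.
  by rewrite e_sym.
have := exy; rewrite adjE => /andP[yx yNx]; rewrite /G2_33_edge /=; apply/orP.
case: (separation_cover x sp) => [xS|xA|xB].
- by left; apply: extremal_cut_arc.
- have [yS|yS] := boolP (y \in [set w; w1]).
    by right; apply: extremal_cut_arc; rewrite // e_sym.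
  left; rewrite /G2_33_arc /= xA (separation_nbr_left sp xA yNx yS) eq_sym yx.
  by rewrite !orbT.
- have [yS|yS] := boolP (y \in [set w; w1]).
    by right; apply: extremal_cut_arc; rewrite // e_sym.
  have yB := separation_nbr_left (separationC sp) xB yNx yS.
  have [xv1|xv1] := eqVneq x v1.
    by left; rewrite /G2_33_arc /= !in_setD1 -xv1 eqxx yx yB !orbT.
  have [yv1|yv1] := eqVneq y v1.
    by right; rewrite /G2_33_arc /= !in_setD1 -yv1 eqxx eq_sym yx xB !orbT.
  by left; rewrite /G2_33_arc /= !in_setD1 xv1 xB yv1 yB eq_sym yx.
Qed.

Lemma extremal_in_G2_33 : in_G2_33 e.
Proof.
have [[wA wB] [w1A w1B]] := (w_notin_sides, w1_notin_sides).
have [_ v1A] := separation_leftF (separationC sp) v1B.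
exists J1, A, u1, u2, w, w1, v1; split; last exact: extremal_edge.
- split.
  + have := leq_trans (nbhd_gt3 v1) (subset_leq_card end_nbhd_far).
    by rewrite (cardsD1 v1 B) v1B.
  + have /subset_leq_card : N[u1] \subset w |: A.
      apply/subsetP => x xNu1; rewrite in_setU1 orbC.
      have [/set2P[->|xw1]|xS] := boolP (x \in [set w; w1]).
      * by rewrite eqxx orbT.
      * by rewrite xw1 nbhdC (negbTE u1Nw1) in xNu1.
      * by rewrite (separation_nbr_left sp u1A xNu1 xS).
    by rewrite cardsU1 wA => /(leq_trans (nbhd_gt3 u1)).
  + rewrite disjoint_sym disjoint_subset; apply/subsetP => x xA.
    have [_ /negbTE xB] := separation_leftF sp xA.
    by rewrite inE in_setD1 xB andbF.
- by [].
- split.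
    rewrite /= !inE !negb_or andbT eq_sym w1_neq_w /=.
    by apply/andP; split; apply: contraTneq v1B => <-.
  rewrite disjoint_sym disjoint_subset; apply/subsetP => x.
  rewrite !inE -orbA => /or3P[]/eqP->; last by rewrite eqxx.
  + by rewrite (negbTE wA) (negbTE wB) andbF.
  + by rewrite (negbTE w1A) (negbTE w1B) andbF.
- apply/setP => x; rewrite !inE.
  have [/set2P[]->|->|xB] := separation_cover x sp; rewrite ?eqxx ?orbT //.
  by rewrite xB andbT; case: eqP; rewrite ?orbT.
Qed.

End Extremal.

Section Matching.

Variables I S A B : {set T}.
Hypotheses (sp : separation S A B) (indI : independent e I).
Hypotheses (I_gt2 : 2 < #|I|) (card_I : #|I| = #|S|.+1).

Definition missed z := I :\: N[z].

(* Every vertex [a] of [I :\: S] but [a0] is the only vertex of [I] missed by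
   some [z] in [S :\: I], which exhausts [S :\: I]. *)
Definition matching_root a0 : Prop :=
  [/\ a0 \in I :\: S, {in S :\: I &, injective missed},
      {in S :\: I, forall z,
         exists2 a, a \in I :\: S :\ a0 & dominates_but a0 z a}
    & {in I :\: S :\ a0, forall a,
         exists2 z, z \in S :\: I & dominates_but a0 z a}].

Lemma independent_not_dominating a b :
  a \in I -> b \in I -> ~~ dominating_pair e a b.
Proof.
move=> aI bI; apply/negP => /dominating_pairP dom.
have [c cI /andP[ca cb]] := card_gt2_other a b I_gt2.
have := dom c; rewrite !(independent_closed_nbhd indI) //.
by rewrite (negbTE ca) (negbTE cb) => /(_ isT).
Qed.

Lemma missed_set1 z a c :
  missed z = [set a] -> c \in I -> (c \in N[z]) = (c != a).
Proof.
by move=> /setP/(_ c); rewrite in_setD in_set1 => <- ->; rewrite andbT negbK.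
Qed.

Lemma dominates_but_independent a z b :
  a \in I -> b \in I -> dominates_but a z b -> z \notin I /\ missed z = [set b].
Proof.
move=> aI bI /dominates_butP[zNa bNa bNz dom].
have adj c : c \in I -> (c \in N[a]) = (c == a).
  exact: independent_closed_nbhd.
split.
  apply/negP => zI; have /eqP za : z == a by rewrite -adj.
  have [c cI /andP[ca cb]] := card_gt2_other a b I_gt2.
  by have := dom c cb; rewrite za adj // (negbTE ca) => /(_ isT).
apply/setP => c; rewrite in_setD in_set1.
have [->|cb] := eqVneq c b; first by rewrite bNz.
apply/negbTE; rewrite negb_and negbK orbC; case cI: (c \in I) => //=.
have [->|ca] := eqVneq c a; first by rewrite nbhdC.
by apply: dom; rewrite // adj.
Qed.

Lemma missed_or_dominates_but a b : a \in I :\: S -> b \in I :\: S -> b != a ->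
  [set a] \notin missed @: (S :\: I) ->
  exists2 z, z \in S :\: I & dominates_but a z b.
Proof.
move=> /setDP[aI aS] /setDP[bI bS] ba unmissed.
have bNa : b \notin N[a] by rewrite (independent_closed_nbhd indI).
have [dom|[z dom]|[z dom]] := critical_nonadjacent bNa.
- by have := independent_not_dominating aI bI; rewrite dom.
- have [zI _] := dominates_but_independent aI bI dom.
  by exists z; rewrite // in_setD zI (dominates_but_cut sp aS dom).
- have [zI missed_z] := dominates_but_independent bI aI dom.
  case/imsetP: unmissed; exists z; rewrite ?missed_z // in_setD zI.
  exact: dominates_but_cut sp bS dom.
Qed.

(* As [#|S :\: I| < #|I :\: S|], some vertex of [I :\: S] is not missed alone.
   Criticality makes all the others missed alone, so the count is tight. *)
Lemma exists_matching_root : exists a0, matching_root a0.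
Proof.
have card_IS : #|I :\: S| = #|S :\: I|.+1.
  by have := cardsID S I; have := cardsID I S; rewrite [S :&: I]setIC; lia.
have [a0 a0IS unmissed] :
    exists2 a0, a0 \in I :\: S & [set a0] \notin missed @: (S :\: I).
  have /subsetPn[_ /imsetP[a0 a0IS ->]] :
      ~~ (@set1 T @: (I :\: S) \subset missed @: (S :\: I)); last by exists a0.
  apply/negP => /subset_leq_card; rewrite (card_imset _ (@set1_inj T)) card_IS.
  by move/leq_trans/(_ (leq_imset_card _ _)); rewrite ltnn.
have [a0I a0S] := setDP a0IS.
have pair a : a \in I :\: S :\ a0 ->
    exists2 z, z \in S :\: I & dominates_but a0 z a.
  by case/setD1P=> aa0 aIS; apply: missed_or_dominates_but.
have pair_missed a z :
    a \in I :\: S :\ a0 -> dominates_but a0 z a -> missed z = [set a].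
  by case/setD1P=> _ /setDP[aI _] /(dominates_but_independent a0I aI)[].
have card_matched : #|@set1 T @: (I :\: S :\ a0)| = #|S :\: I|.
  rewrite (card_imset _ (@set1_inj T)); move: card_IS.
  by rewrite (cardsD1 a0) a0IS => -[].
have missedE : @set1 T @: (I :\: S :\ a0) = missed @: (S :\: I).
  apply/eqP; rewrite eqEcard card_matched leq_imset_card andbT.
  apply/subsetP => _ /imsetP[a aX ->]; have [z zSI dom] := pair a aX.
  by rewrite -(pair_missed a z) // imset_f.
have missed_inj : {in S :\: I &, injective missed}.
  by apply/imset_injP; rewrite -missedE card_matched.
exists a0; split=> // z zSI.
have /imsetP[a aX missed_z] : missed z \in @set1 T @: (I :\: S :\ a0).
  by rewrite missedE imset_f.
have [z' z'SI dom] := pair a aX; exists a => //.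
by rewrite (missed_inj z z') // missed_z (pair_missed a z').
Qed.

Section RootSide.

Variable a0 : T.
Hypotheses (root : matching_root a0) (a0A : a0 \in A).

Let matched := I :\: S :\ a0.

Let a0I : a0 \in I. Proof. by have [/setDP[]] := root. Qed.

Let a0S : a0 \notin S. Proof. by have [/setDP[]] := root. Qed.

Let nbhd_I a c : a \in I -> c \in I -> (c \in N[a]) = (c == a).
Proof. exact: independent_closed_nbhd. Qed.

Let mem_matched a : a \in matched -> [/\ a \in I, a \notin S & a != a0].
Proof. by case/setD1P=> aa0 /setDP[]. Qed.

Lemma far_independent_matched b : b \in B -> b \in I -> b \in matched.
Proof.
move=> bB bI; have [bS bA] := separation_leftF (separationC sp) bB.
by rewrite in_setD1 in_setD bS bI !andbT; apply: contraNneq bA => ->.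
Qed.

Lemma cut_dominates_but z : z \in S -> z \notin I ->
  exists a, [/\ a \in matched, dominates_but a0 z a & missed z = [set a]].
Proof.
move=> zS zI; have [_ _ /(_ z) match_z _] := root.
have [|a aX dom] := match_z; first by rewrite in_setD zI.
have [aI _ _] := mem_matched aX; exists a; split=> //.
by have [] := dominates_but_independent a0I aI dom.
Qed.

Lemma matched_dominates_but a : a \in matched ->
  exists z, [/\ z \in S, dominates_but a0 z a & missed z = [set a]].
Proof.
move=> aX; have [_ _ _ /(_ a aX)[z /setDP[zS _] dom]] := root.
have [aI _ _] := mem_matched aX; exists z; split=> //.
by have [] := dominates_but_independent a0I aI dom.
Qed.

Lemma far_adj_independent x c :
  x \in B -> x \notin I -> c \in I -> c != a0 -> c \in N[x].
Proof.
move=> xB xI cI ca0; have xNa0 := sep_nonadjacent sp a0A xB.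
have [dom|[z dom]|[z dom]] := critical_nonadjacent xNa0.
- by apply: (dominating_pairP dom); rewrite nbhd_I.
- have [zS _] := dominates_but_across sp a0A dom.
  case/dominates_butP: dom => zNa0 _ _ dom.
  have zI : z \notin I.
    apply: contraL zNa0 => zI; rewrite nbhd_I //.
    by apply: contraNneq a0S => <-.
  have [a [/mem_matched[aI _ aa0] _ missed_z]] := cut_dominates_but zS zI.
  have ax : a != x by apply: contraNneq xI => <-.
  have := dom a ax; rewrite nbhd_I // (missed_set1 missed_z aI) eqxx aa0.
  by move/(_ isT).
- have [zS _] := dominates_but_across (separationC sp) xB dom.
  case/dominates_butP: dom => zNx _ a0Nz dom.
  have zI : z \in I.
    apply: contraR a0Nz => zI.
    have [a [/mem_matched[_ _ aa0] _ missed_z]] := cut_dominates_but zS zI.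
    by rewrite (missed_set1 missed_z) // eq_sym.
  have [->//|cz] := eqVneq c z; apply: contraT => cNx.
  by have := dom c ca0 cNx; rewrite nbhd_I // (negbTE cz).
Qed.

Lemma far_adj_cut x z : x \in B -> x \notin I -> z \in S -> z \in N[x].
Proof.
move=> xB xI zS; have [zI|zI] := boolP (z \in I).
  by apply: far_adj_independent => //; apply: contraNneq a0S => <-.
have [a [/mem_matched[aI _ _] dom _]] := cut_dominates_but zS zI.
have [_ farB] := dominates_but_across sp a0A dom.
by rewrite nbhdC farB //; apply: contraNneq xI => ->.
Qed.

Lemma far_outside_independent : exists2 x, x \in B & x \notin I.
Proof.
have /set0Pn[b bB] := sep_right_neq0 sp.
have [bI|] := boolP (b \in I); last by exists b.
have [x /setD1P[xb xB] xNb] := sep_nbrr sp bB; exists x => //.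
by apply: contraL xNb => xI; rewrite nbhd_I.
Qed.

Lemma matched_far a : a \in matched -> a \in B.
Proof.
move=> /mem_matched[aI aS aa0]; have [x xB xI] := far_outside_independent.
apply: (separation_nbr_left (separationC sp) xB) aS.
exact: far_adj_independent.
Qed.

(* Otherwise [z] and any [x] in [B :\: I] would form a dominating edge. *)
Lemma matched_misses_near a z :
  a \in matched -> dominates_but a0 z a -> exists2 y, y \in A & y \notin N[z].
Proof.
move=> /mem_matched[aI _ aa0] dom.
have [zS farB] := dominates_but_across sp a0A dom.
have [x xB xI] := far_outside_independent.
have [v vNx vNz] := edge_undominated (far_adj_cut xB xI zS).
exists v => //; case: (separation_cover v sp) => // [vS|vB].
  by rewrite far_adj_cut in vNx.
have [va|/(farB v vB)] := eqVneq v a; last by rewrite (negbTE vNz).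
by rewrite va far_adj_independent in vNx.
Qed.

Lemma matched_uniq : {in matched &, forall a b, a = b}.
Proof.
move=> a b aX bX; apply/eqP; rewrite eq_sym; apply: contraT => ba.
have [aI aS aa0] := mem_matched aX; have [bI bS _] := mem_matched bX.
have [aB bB] := (matched_far aX, matched_far bX).
have [z [zS dom_z missed_z]] := matched_dominates_but aX.
have [y yA yNz] := matched_misses_near aX dom_z.
have aNy := sep_nonadjacent sp yA aB; have bNy := sep_nonadjacent sp yA bB.
have [dom|[t dom]|[t dom]] := critical_nonadjacent aNy.
- by have := dominating_pairP dom bNy; rewrite nbhd_I // (negbTE ba).
- have [tS /(_ b bB ba) bNt] := dominates_but_across sp yA dom.
  case/dominates_butP: dom => tNy _ aNt _.
  have tI : t \notin I.
    by apply: contraL bNt => tI; rewrite nbhd_I //; apply: contraNneq bS => ->.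
  have [a' [_ _ missed_t]] := cut_dominates_but tS tI.
  rewrite (missed_set1 missed_t) // negbK in aNt.
  rewrite -(eqP aNt) in missed_t.
  have [_ missed_inj _ _] := root.
  suff zt : z = t by rewrite nbhdC zt tNy in yNz.
  apply: missed_inj; rewrite ?missed_z ?missed_t ?in_setD ?tI //.
  by have [-> _] := dominates_but_independent a0I aI dom_z.
- have [tS _] := dominates_but_across (separationC sp) aB dom.
  case/dominates_butP: dom => tNa _ _ dom.
  have tI : t \notin I.
    by apply: contraL tNa => tI; rewrite nbhd_I //; apply: contraNneq aS => <-.
  have [a' [a'X _ missed_t]] := cut_dominates_but tS tI.
  have [a'I _ _] := mem_matched a'X.
  have a'y : a' != y.
    apply: contraL (matched_far a'X) => /eqP->.
    by have [_] := separation_leftF sp yA.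
  have a'a : a' != a.
    apply: contraTneq tNa => <-.
    by rewrite nbhdC (missed_set1 missed_t) // eqxx.
  have := dom a' a'y; rewrite nbhd_I // (missed_set1 missed_t) // eqxx a'a.
  by move/(_ isT).
Qed.

Lemma cut_independent_uniq a :
  a \in matched -> {in S :&: I &, forall b c, b = c}.
Proof.
move=> aX; have aB := matched_far aX; have [aI aS _] := mem_matched aX.
have no_dominates_but b c z :
    b \in S :&: I -> c \in S :&: I -> ~ dominates_but b z c.
  move=> /setIP[_ bI] /setIP[cS cI] dom.
  have [zI missed_z] := dominates_but_independent bI cI dom.
  have aNz : a \in N[z].
    by rewrite (missed_set1 missed_z) //; apply: contraNneq aS => ->.
  have a0Nz : a0 \in N[z].
    by rewrite (missed_set1 missed_z) //; apply: contraNneq a0S => ->.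
  case: (separation_cover z sp) => [zS|zA|zB].
  - have [a' [/mem_matched[_ a'S _] _]] := cut_dominates_but zS zI.
    by rewrite missed_z => /set1_inj ca'; rewrite -ca' cS in a'S.
  - by have := sep_nonadjacent sp zA aB; rewrite aNz.
  - by have := sep_nonadjacent sp a0A zB; rewrite nbhdC a0Nz.
move=> b c bSI cSI; have [[_ bI] [_ cI]] := (setIP bSI, setIP cSI).
apply/eqP; rewrite eq_sym; apply: contraT => cb.
have cNb : c \notin N[b] by rewrite nbhd_I.
have [dom|[z dom]|[z dom]] := critical_nonadjacent cNb.
- by have := independent_not_dominating bI cI; rewrite dom.
- by case: (no_dominates_but b c z).
- by case: (no_dominates_but c b z).
Qed.

Lemma cut_independent_adj_near b y :
  {in A :\ a0, forall x, a0 \in N[x]} ->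
  b \in S -> b \in I -> y \in A -> y != a0 -> y \in N[b].
Proof.
move=> adj_a0 bS bI yA ya0.
have a0Nb : a0 \notin N[b] by rewrite nbhd_I //; apply: contraNneq a0S => ->.
have [dom|[z dom]|[z dom]] := critical_nonadjacent a0Nb.
- by have := independent_not_dominating bI a0I; rewrite dom.
- have [zI missed_z] := dominates_but_independent bI a0I dom.
  case/dominates_butP: dom => zNb _ a0Nz dom.
  case: (separation_cover z sp) => [zS|zA|zB].
  + have [a [/mem_matched[_ _ aa0] _]] := cut_dominates_but zS zI.
    by rewrite missed_z => /set1_inj a0a; rewrite a0a eqxx in aa0.
  + rewrite adj_a0 // in a0Nz; rewrite in_setD1 zA andbT.
    by apply: contraNneq zI => ->.
  + by apply: contraT => /(dom y ya0); rewrite (separation_adjF sp yA zB).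
- have [zI missed_z] := dominates_but_independent a0I bI dom.
  have [zS _] := dominates_but_across sp a0A dom.
  have [a [/mem_matched[_ aS _] _]] := cut_dominates_but zS zI.
  by rewrite missed_z => /set1_inj ba; rewrite -ba bS in aS.
Qed.

(* If no vertex were matched then [S \subset I] and [B] misses [I], which makes
   [A] a clique up to [a0] and [S] complete to [A :\ a0] and to [B]: any edge
   between [S] and [A :\ a0] would dominate. *)
Lemma matched_neq0 : matched != set0.
Proof.
apply/negP => /eqP matched0.
have S_I z : z \in S -> z \in I.
  move=> zS; apply: contraT => /(cut_dominates_but zS)[a []].
  by rewrite matched0 inE.
have far_cut b z : b \in B -> z \in S -> z \in N[b].
  move=> bB; apply: far_adj_cut => //; apply/negP => bI.
  by have := far_independent_matched bB bI; rewrite matched0 inE.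
have near_clique y v : y \in A -> y != a0 -> v \in A -> v \in N[y].
  move=> yA ya0 vA; have /set0Pn[x xB] := sep_right_neq0 sp.
  have [dom|[z dom]|[z dom]] := critical_nonadjacent (sep_nonadjacent sp yA xB).
  - apply: contraT => /(dominating_pairP dom).
    by rewrite (separation_adjF sp vA xB).
  - have [zS _] := dominates_but_across sp yA dom.
    by case/dominates_butP: dom => _ _ + _; rewrite nbhdC far_cut.
  - have [zS nearA] := dominates_but_across (separationC sp) xB dom.
    have := nearA a0 a0A; rewrite eq_sym nbhd_I ?(S_I _ zS) // => /(_ ya0).
    by move/eqP=> a0z; case/negP: a0S; rewrite a0z.
have cut_near b y : b \in S -> y \in A -> y != a0 -> y \in N[b].
  move=> bS; apply: cut_independent_adj_near (S_I b bS) => //.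
  by move=> x /setD1P[xa0 xA]; apply: near_clique.
have [y /setD1P[ya0 yA] _] := sep_nbrl sp a0A.
have /card_gt0P[b bS] : 0 < #|S| by move: I_gt2; rewrite card_I; lia.
have [v vNb vNy] := edge_undominated (cut_near b y bS yA ya0).
case: (separation_cover v sp) => [vS|vA|vB].
- by rewrite nbhdC cut_near in vNy.
- by rewrite near_clique in vNy.
- by rewrite nbhdC far_cut in vNb.
Qed.

Lemma matching_root_sets : exists a1 w w1,
  [/\ matched = [set a1], S :\: I = [set w] & S :&: I = [set w1]].
Proof.
have /set0Pn[a1 a1X] := matched_neq0.
have eq_set1 (D : {set T}) d :
    d \in D -> {in D &, forall b c, b = c} -> D = [set d].
  move=> dD D_uniq; apply/setP => x; rewrite in_set1.
  by apply/idP/eqP => [xD|->//]; apply: D_uniq.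
have matchedE : matched = [set a1] := eq_set1 matched a1 a1X matched_uniq.
have card_IS : #|I :\: S| = 2.
  by rewrite (cardsD1 a0) in_setD a0S a0I -/matched matchedE cards1.
have card_SI := cardsID I S; have card_IS' := cardsID S I.
have /cards1P[w Ew] : #|S :\: I| == 1.
  by rewrite -eqSS; move: card_SI card_IS'; rewrite [S :&: I]setIC; lia.
have /card_gt0P[w1 w1SI] : 0 < #|S :&: I|.
  by rewrite setIC; move: I_gt2; lia.
exists a1, w, w1; split=> //; exact: eq_set1 w1SI (cut_independent_uniq a1X).
Qed.

Lemma matching_root_in_G2_33 :
  irreflexive e -> (forall x, #|S|.+1 < #|N[x]|) -> in_G2_33 e.
Proof.
move=> e_irr nbhd_gt.
have [a1 [w [w1 [matchedE ESI ESI1]]]] := matching_root_sets.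
have ES : S = [set w; w1] by rewrite -(setID S I) ESI ESI1 setUC.
have a1X : a1 \in matched by rewrite matchedE set11.
have [a1I a1S a10] := mem_matched a1X.
have /setDP[wS wI] : w \in S :\: I by rewrite ESI set11.
have /setIP[w1S w1I] : w1 \in S :&: I by rewrite ESI1 set11.
have w_w1 : w != w1 by apply: contraNneq wI => ->.
have w1a c : c \notin S -> w1 != c by apply: contraNneq => <-.
have [a [+ dom missed_w]] := cut_dominates_but wS wI.
rewrite matchedE => /set1P Ea; rewrite {a}Ea in dom missed_w.
have [u2 u2A u2w] := matched_misses_near a1X dom.
have /dominates_butP[wa0 _ a1w _] := dom.
have sp' : separation [set w; w1] A B by rewrite -ES.
apply: (extremal_in_G2_33 e_irr sp' a0A u2A (matched_far a1X)) => //.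
- by apply: contraNneq u2w => <-; rewrite nbhdC.
- by rewrite (missed_set1 missed_w) ?w1a.
- by rewrite nbhd_I // eq_sym w1a.
- by rewrite nbhd_I // eq_sym w1a.
- move=> b /setD1P[ba1 bB]; have bI : b \notin I.
    apply: contra ba1 => bI.
    by rewrite -in_set1 -matchedE far_independent_matched.
  by rewrite -setUA -ES subUset sub1set far_adj_independent //=;
    apply/subsetP => z; apply: far_adj_cut.
- by move=> x; apply: leq_trans (nbhd_gt x); rewrite ES cards2 w_w1.
Qed.

End RootSide.

End Matching.

End Critical.

Theorem theorem4p1 (T : finType) (e : rel T)
  (e_sym : symmetric e) (e_irr : irreflexive e)
  (e_conn : connected_graph e)
  (e_crit : gamma_c_critical3 e)
  (delta_ge2 : 2 <= min_degree e)
  (kappa_le : kappa e <= min_degree e - 1) :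
  alpha e <= kappa e \/ in_G2_33 e.
Proof.
have [|alpha_gt] := leqP (alpha e) (kappa e); [by left | right].
have nbhd_gt x : (kappa e).+1 < #|closed_nbhd e x|.
  by rewrite card_closed_nbhd // ltnS; have := min_degree_le e x; lia.
have kappa_lt : kappa e < #|T|.-1.
  have /card_gt0P[x _] : 0 < #|T| by have := critical_card_gt2 e_crit; lia.
  by have := leq_trans (nbhd_gt x) (max_card _); lia.
have [S cutS S_kappa] := kappa_attained kappa_lt.
have nbhd_gtS x : #|S|.+1 < #|closed_nbhd e x|.
  exact: leq_ltn_trans (nbhd_gt x).
have [A [B sp]] := vertex_cut_separation e_sym cutS nbhd_gtS.
have S_gt1 := connected_cut_gt1 e_sym e_crit e_conn sp.
have [I indI card_I] := independent_of_card (leq_ltn_trans S_kappa alpha_gt).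
have I_gt2 : 2 < #|I| by rewrite card_I.
have [a0 root] := exists_matching_root e_sym e_crit sp indI I_gt2 card_I.
have in_G2 A' B' (sp' : separation e S A' B') (a0A' : a0 \in A') : in_G2_33 e.
  exact: (matching_root_in_G2_33 e_sym e_crit sp' indI I_gt2 card_I root a0A').
have [/setDP[_ /negbTE a0S] _ _ _] := root.
case: (separation_cover a0 sp) => [|a0A|a0B]; first by rewrite a0S.
  exact: in_G2 sp a0A.
exact: in_G2 (separationC e_sym sp) a0B.
Qed.
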